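(* Suppose the homogeneous polynomial $p\in\mathbb C[y_{ij}]$ is in the ideal generated by $\{y_{mj}:1\le j\le n\}$, i.e. the ideal of polynomial functions on $V^n$ which vanish on $(\ell_0^\perp)^n$. Then $$\theta^*(t,b,R)=\sum_{X\in h+L^n}\Big|p\big(a(t)^{-1}n(b)^{-1}X\big)\exp\big(-\pi R(a(t)^{-1}n(b)^{-1}X)\big)\Big|$$ is exponentially decreasing (as $t\to\infty$) on the Siegel set $\mathfrak S'$.
   Context: $V$ is a $\mathbb Q$-vector space of dimension $m=p_0+1$ with a non-degenerate symmetric bilinear form of signature $(p_0,1)$; $u_0,u_0'\in V$ are isotropic with $(u_0,u_0')=-\frac12$, $\ell_0=\mathbb Qu_0$, $\ell_0'=\mathbb Qu_0'$, $W=\{u_0,u_0'\}^\perp$. $L\subset V$ is a $\mathbb Z$-lattice with $L\subset L^{\#}$, assumed to be of the form $L=(L\cap\ell_0)+(L\cap W)+(L\cap\ell_0')$; $1\le n\le p_0$, $h\in(L^{\#})^n$. Fix a basis $w_1,\dots,w_{m-2}$ of $W$; $y_{ij}$ ($1\le i\le m$, $1\le j\le n$) are the coordinates of $X=(x_1,\dots,x_n)\in V(\mathbb R)^n$ with respect to the basis $u_0,w_1,\dots,w_{m-2},u_0'$ ($y_{mj}$ being the $u_0'$-coordinate of $x_j$). $a(t)$, $t>0$, is the isometry $u_0\mapsto tu_0$, $u_0'\mapsto t^{-1}u_0'$, identity on $W$; $n(b)$, $b\in W(\mathbb R)$, is the isometry $u_0\mapsto u_0$, $x\mapsto x+2(x,b)u_0$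 for $x\in W$, $u_0'\mapsto u_0'+b+(b,b)u_0$. $R$ is a complex-valued quadratic function on $V(\mathbb R)^n$ with positive definite real part. $\mathfrak S'$ is the set of $n(b)a(t)(u_0+u_0')$ with $b$ in a fixed relatively compact open set and $t>t_0$ for a fixed $t_0>0$; exponentially decreasing on it means bounded by $C_1e^{-C_2t}$ for some constants $C_1,C_2>0$. *)

(* Defs.v *)
From HB Require Import structures.
From mathcomp Require Import all_boot all_order all_algebra.
From mathcomp Require Import all_classical all_reals all_analysis.
From mathcomp Require Import complex ring lra.
From mathcomp Require mpoly.
(* The notations of mpoly clash with those of mathcomp-analysis. *)
Import -(notations) mpoly.
Import Order.TTheory GRing.Theory Num.Theory.
Import numFieldNormedType.Exports.

Set Implicit Arguments.
Unset Strict Implicit.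
Unset Printing Implicit Defensive.

Local Open Scope classical_set_scope.
Local Open Scope ring_scope.

Definition has_signature (V : vectType rat) (B : {symmetric V}) (p q : nat) :=
  exists e : (p + q).-tuple V,
    [/\ basis_of fullv e,
        forall i j, i != j -> B (tnth e i) (tnth e j) = 0,
        forall i : 'I_(p + q), (i < p)%N -> 0 < B (tnth e i) (tnth e i) &
        forall i : 'I_(p + q), (p <= i)%N -> B (tnth e i) (tnth e i) < 0].

Definition Zlattice (V : vectType rat) (L : set V) :=
  exists e : (\dim {:V}).-tuple V,
    basis_of fullv e /\
    L = [set x | exists z : 'I_(\dim {:V}) -> int,
                   x = \sum_i tnth e i *~ z i].

Definition dual_lattice (V : vectType rat) (B : {symmetric V}) (L : set V)
  : set V := [set x | forall y, L y -> B x y \is a Num.int].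

Definition perp2 (V : vectType rat) (B : {symmetric V}) (u0 u0' : V)
  : {vspace V} := orthov B (<[u0]> + <[u0']>).

Definition lattice_splits (V : vectType rat) (B : {symmetric V}) (u0 u0' : V)
    (L : set V) :=
  L = [set x | exists x1 x2 x3,
         [/\ L x1 /\ x1 \in <[u0]>%VS,
             L x2 /\ x2 \in perp2 B u0 u0',
             L x3 /\ x3 \in <[u0']>%VS &
             x = x1 + x2 + x3]].

Definition lattice_coset (V : vectType rat) (n : nat) (L : set V)
    (h : {ffun 'I_n -> V}) : set {ffun 'I_n -> V} :=
  [set X | forall j, L (X j - h j)].

(* V(R) = R (x)_Q V, written in the coordinates of the library's canonical
   basis vbasis {:V}; it carries the topology of a space of row vectors. *)
Definition Vreal (R : realType) (V : vectType rat) := 'rV[R]_(\dim {:V}).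

Definition inR (R : realType) (V : vectType rat) (v : V) : Vreal R V :=
  \row_i ratr (coord (vbasis {:V}) i v).
Arguments inR R {V} v.

Definition formR (R : realType) (V : vectType rat) (B : {symmetric V})
    (x y : Vreal R V) : R :=
  \sum_i \sum_j
    x 0 i * y 0 j * ratr (B (tnth (vbasis {:V}) i) (tnth (vbasis {:V}) j)).

Definition spaceR (R : realType) (V : vectType rat) (U : {vspace V})
  : {vspace Vreal R V} := <<[seq inR R v | v <- vbasis U]>>%VS.

(* Since (u0,u0') = -1/2, every x in V(R) is c u0 + x_W + c' u0' with
   c = -2 (x,u0'), c' = -2 (x,u0) and x_W in W(R). *)
Definition cu0 (R : realType) (V : vectType rat) (B : {symmetric V})
  (u0 u0' : V) (x : Vreal R V) : R := - 2 * formR B x (inR R u0').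

Definition cu0' (R : realType) (V : vectType rat) (B : {symmetric V})
  (u0 u0' : V) (x : Vreal R V) : R := - 2 * formR B x (inR R u0).

Definition projW (R : realType) (V : vectType rat) (B : {symmetric V})
    (u0 u0' : V) (x : Vreal R V) : Vreal R V :=
  x - cu0 B u0 u0' x *: inR R u0 - cu0' B u0 u0' x *: inR R u0'.

Definition aiso (R : realType) (V : vectType rat) (B : {symmetric V})
    (u0 u0' : V) (t : R) : 'End(Vreal R V) :=
  linfun (fun x : Vreal R V =>
    cu0 B u0 u0' x *: (t *: inR R u0)
    + projW B u0 u0' x
    + cu0' B u0 u0' x *: (t^-1 *: inR R u0')).

Definition niso (R : realType) (V : vectType rat) (B : {symmetric V})
    (u0 u0' : V) (b : Vreal R V) : 'End(Vreal R V) :=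
  linfun (fun x : Vreal R V =>
    let xW := projW B u0 u0' x in
    cu0 B u0 u0' x *: inR R u0
    + (xW + (2 * formR B xW b) *: inR R u0)
    + cu0' B u0 u0' x *: (inR R u0' + b + formR B b b *: inR R u0)).

Definition adapted_basis (V : vectType rat) (k : nat) (u0 u0' : V)
  (w : k.-tuple V) : k.+2.-tuple V := [tuple of u0 :: rcons w u0'].

Definition ycoord (R : realType) (V : vectType rat) (k n : nat) (u0 u0' : V)
    (w : k.-tuple V) (X : {ffun 'I_n -> Vreal R V}) : 'M[R]_(k.+2, n) :=
  \matrix_(i, j) coord [tuple of map (inR R) (adapted_basis u0 u0' w)] i (X j).

(* C[y_ij], the variable y_ij being the one of index mxvec_index i j. *)
Definition ypoly (R : realType) (m n : nat) := mpoly (m * n) R[i].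

Definition yvar (R : realType) (m n : nat) (i : 'I_m) (j : 'I_n)
  : ypoly R m n := mpolyX R[i] (mnm1 (mxvec_index i j)).

Definition yeval (R : realType) (m n : nat) (p : ypoly R m n)
    (y : 'M[R]_(m, n)) : R[i] :=
  meval (fun k => (mxvec y 0 k)%:C%C) p.

Definition homogeneous_ypoly (R : realType) (m n : nat) (p : ypoly R m n) :=
  exists d, p \is ishomog1 d mdeg.

Definition in_last_row_ideal (R : realType) (k n : nat) (p : ypoly R k.+1 n) :=
  exists q : 'I_n -> ypoly R k.+1 n, p = \sum_j q j * yvar R ord_max j.

Definition quadratic_form (R : realType) (U : lmodType R) (f : U -> R[i]) :=
  exists S : U -> U -> R[i],
    [/\ forall c x y z, S (c *: x + y) z = c%:C%C * S x z + S y z,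
        forall c x y z, S z (c *: x + y) = c%:C%C * S z x + S z y &
        forall x, f x = S x x].

Definition posdef_Re (R : realType) (U : lmodType R) (f : U -> R[i]) :=
  forall x, x != 0 -> 0 < complex.Re (f x).

Definition cexp (R : realType) (z : R[i]) : R[i] :=
  (expR (complex.Re z))%:C%C * (cos (complex.Im z) +i* sin (complex.Im z))%C.

Definition open_in (T : topologicalType) (A D : set T) :=
  exists2 U : set T, open U & A = U `&` D.

Definition siegel_point (R : realType) (V : vectType rat) (B : {symmetric V})
    (u0 u0' : V) (t : R) (b : Vreal R V) : Vreal R V :=
  niso B u0 u0' b (aiso B u0 u0' t (inR R u0 + inR R u0')).

Definition siegel_set (R : realType) (V : vectType rat) (B : {symmetric V})
    (u0 u0' : V) (omega : set (Vreal R V)) (t0 : R) : set (Vreal R V) :=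
  [set z | exists b t, [/\ omega b, t0 < t & z = siegel_point B u0 u0' t b]].

Definition act_inv (R : realType) (V : vectType rat) (B : {symmetric V})
    (u0 u0' : V) (n : nat) (t : R) (b : Vreal R V) (X : {ffun 'I_n -> V})
  : {ffun 'I_n -> Vreal R V} :=
  [ffun j => ((aiso B u0 u0' t)^-1)%VF (((niso B u0 u0' b)^-1)%VF (inR R (X j)))].

(* An unconditional sum of nonnegative terms, with value in [0, +oo]. *)
Definition theta_star (R : realType) (V : vectType rat) (B : {symmetric V})
    (u0 u0' : V) (k n : nat) (w : k.-tuple V) (L : set V)
    (h : {ffun 'I_n -> V}) (p : ypoly R k.+2 n) (t : R) (b : Vreal R V)
    (Q : {ffun 'I_n -> Vreal R V} -> R[i]) : \bar R :=
  \esum_(X in lattice_coset L h)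
    (let Y := act_inv B u0 u0' t b X in
     Normc.normc (yeval p (ycoord u0 u0' w Y) * cexp (- (pi%:C%C * Q Y))))%:E.

Lemma formR_linl (R : realType) (V : vectType rat) (B : {symmetric V})
  (c : R) (x y z : Vreal R V) :
  formR B (c *: x + y) z = c * formR B x z + formR B y z.
Proof.
rewrite /formR mulr_sumr -big_split; apply: eq_bigr => i _.
rewrite mulr_sumr -big_split; apply: eq_bigr => j _.
by rewrite !mxE !mulrDl !mulrA.
Qed.

Lemma formR0l (R : realType) (V : vectType rat) (B : {symmetric V})
  (z : Vreal R V) : formR B 0 z = 0.
Proof.
by rewrite /formR big1 // => i _; rewrite big1 // => j _; rewrite !mxE !mul0r.
Qed.

Lemma symBC (V : vectType rat) (B : {symmetric V}) (x y : V) : B x y = B y x.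
Proof. by rewrite hermC expr0 mul1r. Qed.

Lemma formRC (R : realType) (V : vectType rat) (B : {symmetric V})
  (x y : Vreal R V) : formR B x y = formR B y x.
Proof.
rewrite /formR exchange_big; apply: eq_bigr => i _; apply: eq_bigr => j _.
by rewrite symBC (mulrC (x 0 j)).
Qed.

Lemma formR_inR (R : realType) (V : vectType rat) (B : {symmetric V})
  (x y : V) : formR B (inR R x) (inR R y) = ratr (B x y).
Proof.
rewrite {2}(coord_vbasis (memvf x)) {2}(coord_vbasis (memvf y)).
rewrite linear_sumlz /= rmorph_sum; apply: eq_bigr => i _.
rewrite linear_sumr /= rmorph_sum; apply: eq_bigr => j _.
rewrite !mxE -!tnth_nth.
rewrite [X in _ = ratr X]linearZl_LR /=.
rewrite [X in _ = ratr (_ * X)]linearZr_LR /=.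
by rewrite !rmorphM /= mulrA.
Qed.

Lemma formR_spaceR (R : realType) (V : vectType rat) (B : {symmetric V})
  (u0 u0' : V) (x : Vreal R V) : x \in spaceR R (perp2 B u0 u0') ->
  formR B x (inR R u0) = 0 /\ formR B x (inR R u0') = 0.
Proof.
have key v : v \in (<[u0]> + <[u0']>)%VS ->
    x \in spaceR R (perp2 B u0 u0') -> formR B x (inR R v) = 0.
  move=> vU; rewrite /spaceR => /(@coord_span _ _ _ (in_tuple _)) ->.
  elim/big_ind: _ => [|y z hy hz|i _].
  - exact: formR0l.
  - by rewrite -[y]scale1r formR_linl hy hz mulr0 addr0.
  - rewrite -[_ *: _]addr0 formR_linl.
    rewrite formR0l addr0 /=.
    have hi : (i < size (vbasis (perp2 B u0 u0')))%N.
      by apply: leq_trans (ltn_ord i) _; rewrite size_map.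
    rewrite (nth_map 0) // formR_inR.
    have := @vbasis_mem _ _ (vbasis (perp2 B u0 u0'))`_i _ (mem_nth _ hi).
    by move/mem_orthovP => /(_ _ vU) /= ->; rewrite rmorph0 mulr0.
move=> hx; split; apply: key => //.
  exact: (subvP (addvSl _ _)) (memv_line _).
exact: (subvP (addvSr _ _)) (memv_line _).
Qed.

Lemma aisoE (R : realType) (V : vectType rat) (B : {symmetric V})
    (u0 u0' : V) (t : R) (x : Vreal R V) :
  aiso B u0 u0' t x = cu0 B u0 u0' x *: (t *: inR R u0)
    + projW B u0 u0' x + cu0' B u0 u0' x *: (t^-1 *: inR R u0').
Proof.
rewrite /aiso.
pose f (x : Vreal R V) := cu0 B u0 u0' x *: (t *: inR R u0)
    + projW B u0 u0' x + cu0' B u0 u0' x *: (t^-1 *: inR R u0').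
have lf : linear f.
  move=> c y z; rewrite /f /projW /cu0 /cu0' !formR_linl.
  by apply/rowP => i; rewrite !mxE; ring.
pose F := HB.pack_for {linear Vreal R V -> Vreal R V} f
  (GRing.isLinear.Build _ _ _ _ f lf).
exact: (lfunE F x).
Qed.

Lemma nisoE (R : realType) (V : vectType rat) (B : {symmetric V})
    (u0 u0' : V) (b x : Vreal R V) :
  niso B u0 u0' b x =
    cu0 B u0 u0' x *: inR R u0
    + (projW B u0 u0' x
       + (2 * formR B (projW B u0 u0' x) b) *: inR R u0)
    + cu0' B u0 u0' x *: (inR R u0' + b + formR B b b *: inR R u0).
Proof.
rewrite /niso.
pose f (x : Vreal R V) := cu0 B u0 u0' x *: inR R u0
    + (projW B u0 u0' x
       + (2 * formR B (projW B u0 u0' x) b) *: inR R u0)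
    + cu0' B u0 u0' x *: (inR R u0' + b + formR B b b *: inR R u0).
have lf : linear f.
  move=> c y z.
  have pl : projW B u0 u0' (c *: y + z)
      = c *: projW B u0 u0' y + projW B u0 u0' z.
    by apply/rowP => i; rewrite !mxE /cu0 /cu0' !formR_linl; ring.
  rewrite /f pl /cu0 /cu0' !formR_linl.
  by apply/rowP => i; rewrite !mxE; ring.
pose F := HB.pack_for {linear Vreal R V -> Vreal R V} f
  (GRing.isLinear.Build _ _ _ _ f lf).
exact: (lfunE F x).
Qed.

Lemma aiso_spec (R : realType) (V : vectType rat) (B : {symmetric V})
    (u0 u0' : V) (t : R) :
  B u0 u0 = 0 -> B u0' u0' = 0 -> B u0 u0' = - (1 / 2) ->
  [/\ aiso B u0 u0' t (inR R u0) = t *: inR R u0,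
      aiso B u0 u0' t (inR R u0') = t^-1 *: inR R u0' &
      forall x, x \in spaceR R (perp2 B u0 u0') -> aiso B u0 u0' t x = x].
Proof.
move=> h0 h0' h1; have h1' : B u0' u0 = - (1 / 2) by rewrite symBC.
have hr : ratr (- (1 / 2)) = - (1 / 2) :> R.
  by rewrite rmorphN fmorph_div /= rmorph1 rmorph_nat.
have e2 : - 2 * (- (1 / 2)) = 1 :> R by field.
split=> [||x /formR_spaceR[x0 x0']]; rewrite aisoE /projW /cu0 /cu0'.
- rewrite !formR_inR h0 h1 hr rmorph0 e2 mulr0 !scale1r !scale0r subr0 subrr.
  by rewrite !addr0.
- rewrite !formR_inR h0' h1' hr rmorph0 e2 mulr0 !scale1r !scale0r subr0 subrr.
  by rewrite !add0r.
- by rewrite x0 x0' mulr0 !scale0r !subr0 add0r addr0.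
Qed.

Lemma niso_spec (R : realType) (V : vectType rat) (B : {symmetric V})
    (u0 u0' : V) (b : Vreal R V) :
  B u0 u0 = 0 -> B u0' u0' = 0 -> B u0 u0' = - (1 / 2) ->
  [/\ niso B u0 u0' b (inR R u0) = inR R u0,
      niso B u0 u0' b (inR R u0')
        = inR R u0' + b + formR B b b *: inR R u0 &
      forall x, x \in spaceR R (perp2 B u0 u0') ->
        niso B u0 u0' b x = x + (2 * formR B x b) *: inR R u0].
Proof.
move=> h0 h0' h1; have h1' : B u0' u0 = - (1 / 2) by rewrite symBC.
have hr : ratr (- (1 / 2)) = - (1 / 2) :> R.
  by rewrite rmorphN fmorph_div /= rmorph1 rmorph_nat.
have e2 : - 2 * (- (1 / 2)) = 1 :> R by field.
split=> [||x /formR_spaceR[x0 x0']]; rewrite nisoE /projW /cu0 /cu0'.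
- rewrite !formR_inR h0 h1 hr rmorph0 e2 mulr0 !scale1r !scale0r subr0 subrr formR0l.
  by rewrite mulr0 scale0r !addr0.
- rewrite !formR_inR h0' h1' hr rmorph0 e2 mulr0 !scale1r !scale0r subr0 subrr.
  by rewrite formR0l mulr0 scale0r !add0r.
- by rewrite x0 x0' mulr0 !scale0r !subr0 add0r addr0.
Qed.

(* Main.v *)
Require Import Defs.
From HB Require Import structures.
From mathcomp Require Import all_boot all_order all_algebra.
From mathcomp Require Import all_classical all_reals all_analysis.
From mathcomp Require Import complex ring lra.
Import Order.TTheory GRing.Theory Num.Theory.
Import numFieldNormedType.Exports.
Local Open Scope classical_set_scope.
Local Open Scope ring_scope.

(** Put [Y = a(t)^-1 n(b)^-1 X] and [q Y = Re Q Y].  A positive definite form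
    dominates the square of every linear functional, so [|p(Y)|] is at most a
    constant times [expR (q Y)], and each term of the series is
    [O(expR (- q Y))].  The [u0']-coordinate of [Y_j] is [t] times that of [X_j],
    which takes values in a discrete set; since [p] vanishes when all these
    coordinates do, a nonzero term has [q Y >= c t^2].  Finally [X = n(b) a(t) Y]
    with [b] bounded gives [1 + z^2 <= E t^2 (1 + q Y)] for each of the [N]
    integer coordinates [z] of [X - h].  Splitting [expR (- q Y)] into two halves,
    one yields [expR (- c t^2 / 2)], the other
    [O(t^(2N) \prod_z (1 + z^2)^-1)], whose sum over the lattice is finite. *)

(** * Sums of inverse polynomials over integer vectors *)

(** Telescoping: [1/(1+(M+1)^2) <= 2/(M+1) - 2/(M+2)], so the terms of index at most [M] add up to
    at most [3 - 2/(M+1)], with equality at [M = 0]. *)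
Lemma sum_inv1Dsq_le (R : realType) (M : nat) :
  \sum_(k < M) (1 + k%:R ^+ 2 : R)^-1 <= 3.
Proof.
case: M => [|M]; first by rewrite big_ord0.
suff: \sum_(k < M.+1) (1 + k%:R ^+ 2 : R)^-1 <= 3 - 2 / M.+1%:R.
  by move/le_trans; apply; rewrite gerBl divr_ge0.
elim: M => [|M IH]; first by rewrite big_ord1 /= expr0n /= addr0 invr1; lra.
rewrite big_ord_recr /=.
apply: le_trans (lerD IH (lexx _)) _.
have M0 : 0 <= M%:R :> R by [].
rewrite -[M.+2]addn2 -[M.+1]addn1 !natrD.
set x := M%:R in M0 *.
have -> : 3 - 2 / (x + 2) = 3 - 2 / (x + 1) + 2 / ((x + 1) * (x + 2)).
  by field; apply/andP; split; apply: lt0r_neq0; lra.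
rewrite lerD2l ler_pdivlMr; last by apply: mulr_gt0; lra.
rewrite mulrC ler_pdivrMr; last by apply: ltr_pwDl => //; apply: sqr_ge0.
nra.
Qed.

(** Parametrising [int] by a product type turns a box of integers into the finite type
    [bool * 'I_M], over which sums of products can be distributed. *)
Definition int_of_sgnat (x : bool * nat) : int :=
  if x.1 then Posz x.2 else Negz x.2.

(** The sequence [r] may repeat elements: its sum runs over [undup r] with multiplicities at least
    one. Hence an enumeration can serve as [r] without a proof that it is injective. *)
Lemma sum_uniq_subset (R : realType) (T : eqType) (s r : seq T) (F : T -> R) :
  uniq s -> {subset s <= r} -> (forall x, 0 <= F x) ->
  \sum_(x <- s) F x <= \sum_(x <- r) F x.
Proof.
move=> us sr F0; rewrite -(big_undup_iterop_count _ r) /=.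
have -> : \sum_(x <- s) F x = \sum_(x <- undup r | x \in s) F x.
  rewrite -[RHS]big_filter; apply: perm_big; apply: uniq_perm => //.
    by rewrite filter_uniq // undup_uniq.
  move=> x; rewrite mem_filter mem_undup.
  by case xs: (x \in s) => //=; rewrite sr.
rewrite big_mkcond /= big_seq [leRHS]big_seq; apply: ler_sum => x.
rewrite mem_undup -has_pred1 has_count; case: (count _ _) => // c _.
rewrite Monoid.iteropE iter_addr addr0.
case: ifP => _; last by rewrite mulrn_wge0.
by rewrite mulrS lerDl mulrn_wge0.
Qed.

(** The list lies in a box, and over a box the sum of products is the product of one-variable sums.
    Each of these is at most [3 + 3], one 3 for each sign. *)
Lemma sum_prod_inv1Dsq_le (R : realType) (I : finType)
    (s : seq {ffun I -> int}) : uniq s ->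
  \sum_(z <- s) \prod_i (1 + (z i)%:~R ^+ 2 : R)^-1 <= 6 ^+ #|I|.
Proof.
move=> us.
pose M := (\max_(z <- s) \max_i `|z i|).+1.
pose J : finType := (bool * 'I_M)%type.
pose dec (f : {ffun I -> J}) : {ffun I -> int} :=
  [ffun i => int_of_sgnat ((f i).1, val (f i).2)].
have inv_ge0 (z : int) : 0 <= (1 + z%:~R ^+ 2 : R)^-1.
  by rewrite invr_ge0 addr_ge0 ?sqr_ge0.
apply: (@le_trans _ _ (\sum_(z <- [seq dec f | f <- enum {ffun I -> J}])
    \prod_i (1 + (z i)%:~R ^+ 2)^-1)).
  apply: sum_uniq_subset => // [z zs|z]; last first.
    by apply: prodr_ge0.
  have zM i : (`|z i| < M)%N.
    rewrite ltnS; apply: leq_trans (leq_bigmax_seq _ zs _) => //.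
    exact: (@leq_bigmax_cond I predT (fun i => `|z i|%N)).
  have zM' i : ((match z i with Posz k => k | Negz k => k end) < M)%N.
    by have := zM i; case: (z i) => k //=; apply: ltn_trans.
  apply/mapP; exists [ffun i => (if z i is Posz _ then true else false,
                                 Ordinal (zM' i))].
    by rewrite mem_enum.
  by apply/ffunP => i; rewrite !ffunE /int_of_sgnat /=; case: (z i).
rewrite big_map big_enum /=.
under eq_bigr do under eq_bigr do rewrite ffunE.
rewrite -(bigA_distr_bigA (fun (i : I) (j : J) =>
  (1 + (int_of_sgnat (j.1, val j.2))%:~R ^+ 2)^-1)) /=.
rewrite prodr_const cardT -cardE.
apply: lerXn2r; rewrite ?nnegrE //; first by apply: sumr_ge0.
rewrite -(pair_bigA _ (fun (b : bool) (k : 'I_M) =>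
  (1 + (int_of_sgnat (b, val k))%:~R ^+ 2 : R)^-1)) /=.
rewrite big_bool /= /int_of_sgnat /=.
have -> : 6 = 3 + 3 :> R by lra.
apply: lerD; first exact: sum_inv1Dsq_le.
(* [Negz k] is [-(k+1)], whose square is at least [k^2], so the negative half is bounded by the same
   sum. *)
apply: le_trans (sum_inv1Dsq_le R M); apply: ler_sum => k _.
rewrite lef_pV2 ?posrE ?ltr_pwDl ?sqr_ge0 // lerD2l.
by rewrite NegzE mulrNz sqrrN lerXn2r ?nnegrE ?ler0z // ler_nat.
Qed.

(** * Linear forms and polynomials against a positive definite form *)

(** Induction on [N]: half of the rate [c] pays for one factor, by [1 + x <= (1 + 2/c)(1 + cx/2) <=
    (1 + 2/c) exp(cx/2)], and the other half pays for the remaining power. *)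
Lemma expr1D_le_expR (R : realType) (N : nat) (c : R) : 0 < c ->
  exists2 A, 0 < A & forall x, 0 <= x -> (1 + x) ^+ N <= A * expR (c * x).
Proof.
elim: N c => [|N IH] c c0.
  exists 1 => // x x0; rewrite expr0 mul1r.
  by apply: le_trans (expR_ge1Dx _); rewrite lerDl mulr_ge0 // ltW.
have c20 : 0 < c / 2 by rewrite divr_gt0.
have [A A0 HA] := IH _ c20.
have D0 : 0 < 1 + (c / 2)^-1 by rewrite addr_gt0 // invr_gt0.
exists ((1 + (c / 2)^-1) * A) => [|x x0]; first exact: mulr_gt0.
have -> : c * x = c / 2 * x + c / 2 * x by field.
rewrite expRD exprS mulrACA ler_pM ?exprn_ge0 ?addr_ge0 ?HA //.
apply: (@le_trans _ _ ((1 + (c / 2)^-1) * (1 + c / 2 * x))); last first.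
  by rewrite ler_pM2l // expR_ge1Dx.
have -> : (1 + (c / 2)^-1) * (1 + c / 2 * x) = 1 + x + (c / 2 * x + (c / 2)^-1).
  by field; apply: lt0r_neq0.
by rewrite lerDl addr_ge0 ?mulr_ge0 // ltW // invr_gt0.
Qed.

Lemma linear_fun_sum (R : realType) (U : lmodType R) (l : U -> R) (I : finType)
    (c : I -> R) (e : I -> U) :
  (forall a x y, l (a *: x + y) = a * l x + l y) ->
  l (\sum_i c i *: e i) = \sum_i c i * l (e i).
Proof.
move=> ll; have l0 : l 0 = 0.
  by have := ll (-1) 0 0; rewrite scaler0 addr0 mulN1r addNr.
by elim/big_rec2: _ => [//|i y1 y2 _ <-]; rewrite ll.
Qed.

Lemma psd_Cauchy_Schwarz (R : realType) (U : lmodType R) (G : U -> U -> R)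
    (x y : U) :
  (forall a u v z, G (a *: u + v) z = a * G u z + G v z) ->
  (forall u v, G u v = G v u) -> (forall u, u != 0 -> 0 < G u u) ->
  G x y ^+ 2 <= G x x * G y y.
Proof.
move=> Gl GC Gpos.
have G0 z : G 0 z = 0.
  by have := Gl (-1) 0 0 z; rewrite scaler0 addr0 mulN1r addNr.
have [->|/Gpos y0] := eqVneq y 0; first by rewrite GC !G0 expr0n mulr0.
(* The value of [a] that minimises [G (a *: y + x) (a *: y + x)]. *)
set a := - (G x y / G y y).
have: 0 <= G (a *: y + x) (a *: y + x).
  by have [->|/Gpos/ltW//] := eqVneq (a *: y + x) 0; rewrite G0.
rewrite Gl [G y _]GC [G x _]GC !Gl [G y x]GC.
have -> : a * (a * G y y + G x y) + (a * G x y + G x x) =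
          G x x - G x y ^+ 2 / G y y.
  by rewrite /a; field; apply: lt0r_neq0.
by rewrite subr_ge0 ler_pdivrMr.
Qed.

Lemma ReM_real (R : realType) (c : R) (z w : R[i]) :
  complex.Re (c%:C%C * z + w) = c * complex.Re z + complex.Re w.
Proof. by case: z => a b; case: w => u v /=; ring. Qed.

(* The Riesz vector [a] of [l] for the polarised form [G], together with
   Cauchy-Schwarz [G x a ^+ 2 <= G x x * G a a]. *)
Lemma posdef_dominates_linear (R : realType) (U : vectType R) (Q : U -> R[i])
    (l : U -> R) :
  quadratic_form Q -> posdef_Re Q ->
  (forall a x y, l (a *: x + y) = a * l x + l y) ->
  exists2 C, 0 <= C & forall x, l x ^+ 2 <= C * complex.Re (Q x).
Proof.
move=> [S [Sl Sr QS]] Qpos ll.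
(* [S] need not be symmetric. Symmetrising gives [G u u = 2 Re (Q u)], the source of the factor 2 in
   [Gxx]. *)
pose G x y := complex.Re (S x y) + complex.Re (S y x).
have Gl a u v z : G (a *: u + v) z = a * G u z + G v z.
  by rewrite /G Sl Sr !ReM_real; ring.
have GC u v : G u v = G v u by rewrite /G addrC.
have Gxx u : G u u = 2 * complex.Re (Q u) by rewrite /G QS; ring.
have Gpos u : u != 0 -> 0 < G u u.
  by move=> /Qpos Qu; rewrite Gxx mulr_gt0.
pose d := \dim {:U}; pose e := vbasis {:U}.
pose A : 'M[R]_d := \matrix_(i, j) G e`_i e`_j.
have GA (v w : 'I_d -> R) :
    G (\sum_i v i *: e`_i) (\sum_i w i *: e`_i) =
    ((\row_i v i) *m A *m (\col_i w i)) 0 0.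
  rewrite (@linear_fun_sum _ _ (G^~ _)) // -mulmxA mxE; apply: eq_bigr => i _.
  rewrite GC (@linear_fun_sum _ _ (G^~ _)) // !mxE; congr (_ * _).
  by apply: eq_bigr => j _; rewrite !mxE mulrC GC.
have eb : basis_of fullv e by exact: vbasisP.
have uA : A \in unitmx.
  (* A row [v] killed by the Gram matrix is the coordinate row of some [x] with [G x x = 0];
     definiteness gives [x = 0], and freeness of the basis [v = 0]. *)
  rewrite -row_free_unit -kermx_eq0; apply/rowV0P => v /sub_kermxP vA.
  have := GA (v 0) (v 0).
  have -> : \row_i v 0 i = v by apply/rowP => i; rewrite mxE.
  rewrite vA mul0mx mxE => Gv0; set x := \sum_i _ in Gv0.
  have x0 : x = 0.
    by apply/eqP; apply: contraT => /Gpos; rewrite Gv0 ltxx.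
  apply/rowP => i; rewrite [RHS]mxE.
  have := coord_sum_free (v 0) i (basis_free eb).
  by rewrite -/x x0 linear0.
pose c := invmx A *m \col_i l e`_i.
pose a := \sum_i c i 0 *: e`_i.
have la x : l x = G x a.
  rewrite {2}(coord_basis eb (memvf x)) GA -mulmxA.
  have -> : \col_i c i 0 = c by apply/colP => i; rewrite mxE.
  rewrite /c mulKVmx // {1}(coord_basis eb (memvf x)) linear_fun_sum // mxE.
  by apply: eq_bigr => i _; rewrite !mxE.
exists (2 * G a a) => [|x].
  rewrite mulr_ge0 //; have [->|/Gpos/ltW//] := eqVneq a 0.
  by have := Gl (-1) 0 0 0; rewrite scaler0 addr0 mulN1r addNr => ->.
rewrite la mulrAC -Gxx; exact: psd_Cauchy_Schwarz.
Qed.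

Lemma normc_ge0 (R : realType) (z : R[i]) : 0 <= Normc.normc z.
Proof. by case: z => a b; apply: sqrtr_ge0. Qed.

Lemma normcR (R : realType) (x : R) : Normc.normc x%:C%C = `|x|.
Proof. by rewrite /= expr0n addr0 sqrtr_sqr. Qed.

Lemma normc_cexp (R : realType) (z : R[i]) :
  Normc.normc (cexp z) = expR (complex.Re z).
Proof.
rewrite /cexp Normc.normcM normcR ger0_norm ?expR_ge0 //=.
by rewrite cos2Dsin2 sqrtr1 mulr1.
Qed.

(** Each variable is at most [(1 + D)(1 + q Y)] in absolute value, so a monomial of degree [M] is at
    most the [M]-th power of this, which is [O(expR (q Y))]. The constants are then added along the
    support of [p]. *)
Lemma normc_mpoly_le (R : realType) (T : Type) (N : nat) (p : mpoly.mpoly N R[i])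
    (x : T -> 'I_N -> R) (q : T -> R) (C : 'I_N -> R) :
  (forall Y, 0 <= q Y) -> (forall i, 0 <= C i) ->
  (forall Y i, x Y i ^+ 2 <= C i * q Y) ->
  exists2 A, 0 < A & forall Y,
    Normc.normc (mpoly.meval (fun i => (x Y i)%:C%C) p) <= A * expR (q Y).
Proof.
move=> q0 C0 xq.
have sum_le Y : Normc.normc (mpoly.meval (fun i => (x Y i)%:C%C) p) <=
    \sum_(m <- mpoly.msupp p) Normc.normc (mpoly.mcoeff m p) *
      \prod_i `|x Y i| ^+ mpoly.fun_of_multinom m i.
  rewrite mpoly.mevalE; elim/big_ind2: _ => [|z1 r1 z2 r2 h1 h2|m _].
  - by rewrite Normc.normc0.
  - exact: le_trans (le_normcD _ _) (lerD h1 h2).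
  - rewrite Normc.normcM ler_wpM2l ?normc_ge0 //.
    elim/big_ind2: _ => [|z1 r1 z2 r2 h1 h2|i _]; first by rewrite Normc.normc1.
      by rewrite Normc.normcM ler_pM ?normc_ge0.
    by rewrite -rmorphXn /= expr0n addr0 sqrtr_sqr normrX.
pose D := \sum_i (1 + C i).
have x_le Y i : `|x Y i| <= (1 + D) * (1 + q Y).
  have sq : `|x Y i| ^+ 2 <= D * q Y.
    rewrite real_normK ?num_real //; apply: le_trans (xq Y i) _.
    rewrite ler_wpM2r // /D (bigD1 i) //= -addrA addrCA lerDl.
    by rewrite addr_ge0 // sumr_ge0 // => j _; rewrite addr_ge0.
  have D0 : 0 <= D by rewrite sumr_ge0 // => j _; rewrite addr_ge0.
  have := q0 Y; have := normr_ge0 (x Y i); nra.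
suff [A A0 HA] : exists2 A, 0 < A & forall Y,
   \sum_(m <- mpoly.msupp p) Normc.normc (mpoly.mcoeff m p) *
      \prod_i `|x Y i| ^+ mpoly.fun_of_multinom m i <= A * expR (q Y).
  by exists A => // Y; apply: le_trans (sum_le Y) (HA Y).
elim: (mpoly.msupp p) => [|m s [A A0 HA]].
  by exists 1 => // Y; rewrite big_nil mul1r expR_ge0.
have D0 : 0 <= 1 + D.
  by rewrite addr_ge0 // sumr_ge0 // => j _; rewrite addr_ge0.
pose M := (\sum_i mpoly.fun_of_multinom m i)%N.
have [A' A'0 HA'] := expr1D_le_expR _ M _ (ltr01 : 0 < 1 :> R).
pose K := Normc.normc (mpoly.mcoeff m p) * (1 + D) ^+ M.
have K0 : 0 <= K by rewrite mulr_ge0 ?normc_ge0 ?exprn_ge0.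
exists (K * A' + A) => [|Y]; first by rewrite ltr_wpDl // mulr_ge0 // ltW.
rewrite big_cons mulrDl lerD // /K -!mulrA ler_wpM2l ?normc_ge0 //.
apply: (@le_trans _ _ (((1 + D) * (1 + q Y)) ^+ M)).
  rewrite /M -prodrXr; apply: ler_prod => i _.
  by rewrite exprn_ge0 //= lerXn2r ?nnegrE // mulr_ge0 // addr_ge0.
rewrite exprMn ler_wpM2l ?exprn_ge0 //.
by have := HA' _ (q0 Y); rewrite mul1r.
Qed.

(** * Uniform bounds up to a constant *)

(** This is [F = O(W)] uniformly on [D]; the weight [fun=> 1] expresses boundedness. Closure under
    sums and under multiplication by bounded functions lets a bound follow from the shape of an
    expression. *)
Definition dominated {R : realType} {T : Type} (D : set T) (W F : T -> R) :=
  exists2 C, 0 <= C & forall x, D x -> `|F x| <= C * W x.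

Lemma eq_dominated {R : realType} {T : Type} {D : set T} {W : T -> R}
    (F G : T -> R) :
  F =1 G -> dominated D W F -> dominated D W G.
Proof. by move=> /funext ->. Qed.

Lemma dominatedD {R : realType} {T : Type} {D : set T} {W F G : T -> R} :
  dominated D W F -> dominated D W G -> dominated D W (fun x => F x + G x).
Proof.
move=> [C C0 HC] [K K0 HK]; exists (C + K) => [|x Dx]; first exact: addr_ge0.
by rewrite mulrDl; apply: le_trans (ler_normD _ _) (lerD (HC _ Dx) (HK _ Dx)).
Qed.

Lemma dominatedM {R : realType} {T : Type} {D : set T} {W F G : T -> R} :
  dominated D (fun=> 1) F -> dominated D W G ->
  dominated D W (fun x => F x * G x).
Proof.
move=> [C C0 HC] [K K0 HK]; exists (C * K) => [|x Dx]; first exact: mulr_ge0.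
rewrite normrM -mulrA ler_pM ?HK //.
by have := HC _ Dx; rewrite mulr1.
Qed.

Lemma dominated_cst {R : realType} {T : Type} (D : set T) (c : R) :
  dominated D (fun=> 1) (fun=> c).
Proof. by exists `|c| => // x _; rewrite mulr1. Qed.

Lemma dominated_sum {R : realType} {T : Type} {D : set T} {W : T -> R}
    (I : finType) (F : I -> T -> R) :
  (forall i, dominated D W (F i)) ->
  dominated D W (fun x => \sum_i F i x).
Proof.
move=> HF; have [C HC] := choice (fun i => let: ex_intro2 c c0 h := HF i in
  ex_intro (fun c => 0 <= c /\ forall x, D x -> `|F i x| <= c * W x) c (conj c0 h)).
exists (\sum_i C i) => [|x Dx].
  by apply: sumr_ge0 => i _; case: (HC i).
rewrite mulr_suml; apply: le_trans (ler_norm_sum _ _ _) _.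
by apply: ler_sum => i _; case: (HC i) => _; apply.
Qed.

(** * Extension of scalars and adapted bases *)

Lemma inR_linear (R : realType) (V : vectType rat) (a : rat) (x y : V) :
  inR R (a *: x + y) = ratr a *: inR R x + inR R y.
Proof. by apply/rowP => i; rewrite !mxE linearP /= rmorphD rmorphM. Qed.

Lemma inR_sum (R : realType) (V : vectType rat) (I : finType) (c : I -> rat)
    (v : I -> V) :
  inR R (\sum_i c i *: v i) = \sum_i ratr (c i) *: inR R (v i).
Proof.
elim/big_rec2: _ => [|i y1 y2 _ <-]; last by rewrite inR_linear.
by apply/rowP => i; rewrite !mxE linear0 rmorph0.
Qed.

(** By a dimension count it is enough to span: the span contains every [inR R v], and the images of
    [vbasis] are the standard row vectors. *)
Lemma inR_basis (R : realType) (V : vectType rat) (k : nat) (e : k.-tuple V) :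
  basis_of fullv e -> basis_of fullv [tuple of map (inR R) e].
Proof.
move=> eb; rewrite basisEdim; apply/andP; split; last first.
  rewrite size_map size_tuple -(size_basis eb).
  by rewrite [leqRHS]dimvf dim_matrix mul1r.
have mem v : inR R v \in <<map (inR R) e>>%VS.
  rewrite (coord_basis eb (memvf v)) inR_sum; apply: memv_suml => i _.
  apply: memvZ; apply: memv_span; apply: map_f; apply: mem_nth.
  by rewrite size_tuple.
apply/subvP => x _.
have -> : x = \sum_i x 0 i *: inR R (vbasis {:V})`_i.
  apply/rowP => j; rewrite summxE (bigD1 j) //= !mxE.
  rewrite (coord_free _ _ (basis_free (vbasisP _))) eqxx rmorph1 mulr1.
  rewrite big1 ?addr0 // => i ij; rewrite !mxE.
  by rewrite (coord_free _ _ (basis_free (vbasisP _))) (negPf ij) rmorph0 mulr0.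
by apply: memv_suml => i _; apply: memvZ.
Qed.

Lemma symB_linl (V : vectType rat) (B : {symmetric V}) (a : rat) (x y z : V) :
  B (a *: x + y) z = a * B x z + B y z.
Proof. by rewrite linearDl linearZl_LR. Qed.

(** By a dimension count it is enough to span. Since [(u0,u0') = -1/2], pairing [v] with [u0'] and
    [u0] reads off its two isotropic components; subtracting them leaves a vector of [W]. *)
Lemma adapted_basisP (V : vectType rat) (B : {symmetric V}) (k : nat)
    (u0 u0' : V) (w : k.-tuple V) :
  B u0 u0 = 0 -> B u0' u0' = 0 -> B u0 u0' = - (1 / 2) ->
  \dim {:V} = k.+2 -> basis_of (perp2 B u0 u0') w ->
  basis_of fullv (adapted_basis u0 u0' w).
Proof.
move=> h0 h0' h1 hd wb; have h1' : B u0' u0 = - (1 / 2) by rewrite symBC.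
rewrite basisEdim hd size_tuple leqnn andbT; apply/subvP => v _.
pose a := - 2 * B v u0'; pose c := - 2 * B v u0.
pose v' := - a *: u0 + (- c *: u0' + v).
have BE z : B v' z = - a * B u0 z + (- c * B u0' z + B v z).
  by rewrite /v' !symB_linl.
have -> : v = a *: u0 + (v' + c *: u0').
  by rewrite /v' !scaleNr addrA addrA subrr add0r addrAC addNr add0r.
have v'w : v' \in perp2 B u0 u0'.
  apply/mem_orthovP => z /memv_addP[_ /vlineP[r ->] [_ /vlineP[r' ->] ->]].
  rewrite ![B v' _]symBC symB_linl -[r' *: _]addr0 symB_linl linear0l
    ![B _ v']symBC !BE h0 h0' h1 h1' /a /c.
  by field.
have sub x : x \in u0 :: rcons w u0' -> x \in <<adapted_basis u0 u0' w>>%VS.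
  exact: memv_span.
apply: memvD; first by apply/memvZ/sub; rewrite inE eqxx.
apply: memvD; last by apply/memvZ/sub; rewrite inE mem_rcons inE eqxx orbT.
have : v' \in <<w>>%VS by rewrite (span_basis wb).
apply/subvP/span_subvP => x xw; apply: sub.
by rewrite inE mem_rcons inE xw !orbT.
Qed.

(** * The action of [a(t)] and [n(b)] in coordinates along [u0], [W], [u0'] *)

Lemma cu0_linear (R : realType) (V : vectType rat) (B : {symmetric V})
    (u0 u0' : V) (c : R) (x y : Vreal R V) :
  cu0 B u0 u0' (c *: x + y) = c * cu0 B u0 u0' x + cu0 B u0 u0' y.
Proof. by rewrite /cu0 formR_linl; ring. Qed.

Lemma cu0'_linear (R : realType) (V : vectType rat) (B : {symmetric V})
    (u0 u0' : V) (c : R) (x y : Vreal R V) :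
  cu0' B u0 u0' (c *: x + y) = c * cu0' B u0 u0' x + cu0' B u0 u0' y.
Proof. by rewrite /cu0' formR_linl; ring. Qed.

Lemma projW_linear (R : realType) (V : vectType rat) (B : {symmetric V})
    (u0 u0' : V) (c : R) (x y : Vreal R V) :
  projW B u0 u0' (c *: x + y) = c *: projW B u0 u0' x + projW B u0 u0' y.
Proof. by apply/rowP => i; rewrite !mxE cu0_linear cu0'_linear; ring. Qed.

Lemma cu0_decomp (R : realType) (V : vectType rat) (B : {symmetric V})
    (u0 u0' : V) (x : Vreal R V) :
  x = cu0 B u0 u0' x *: inR R u0 +
      (projW B u0 u0' x + cu0' B u0 u0' x *: inR R u0').
Proof. by rewrite /projW addrNK addrC addrNK. Qed.

Lemma cu0_lattice (R : realType) (V : vectType rat) (B : {symmetric V})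
    (u0 u0' : V) :
  B u0 u0 = 0 -> B u0' u0' = 0 -> B u0 u0' = - (1 / 2) ->
  [/\ cu0 B u0 u0' (inR R u0) = 1, cu0 B u0 u0' (inR R u0') = 0,
      cu0' B u0 u0' (inR R u0) = 0 & cu0' B u0 u0' (inR R u0') = 1].
Proof.
move=> h0 h0' h1; have h1' : B u0' u0 = - (1 / 2) by rewrite symBC.
have hr : ratr (- (1 / 2)) = - (1 / 2) :> R.
  by rewrite rmorphN fmorph_div /= rmorph1 rmorph_nat.
rewrite /cu0 /cu0' !formR_inR h0 h0' h1 h1' hr rmorph0 mulr0.
by split => //; field.
Qed.

(** Uniqueness of the decomposition: coordinates of an image under [a(t)] or [n(b)] are read off
    once it is written in this form. *)
Lemma cu0_combE (R : realType) (V : vectType rat) (B : {symmetric V})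
    (u0 u0' : V) (a c : R) (x : Vreal R V) :
  B u0 u0 = 0 -> B u0' u0' = 0 -> B u0 u0' = - (1 / 2) ->
  cu0 B u0 u0' x = 0 -> cu0' B u0 u0' x = 0 ->
  let y := a *: inR R u0 + (c *: inR R u0' + x) in
  [/\ cu0 B u0 u0' y = a, cu0' B u0 u0' y = c & projW B u0 u0' y = x].
Proof.
move=> h0 h0' h1 x0 x0' y.
have [e1 e2 e3 e4] := cu0_lattice R V B u0 u0' h0 h0' h1.
have ya : cu0 B u0 u0' y = a.
  by rewrite /y !cu0_linear e1 e2 x0 mulr1 mulr0 !addr0.
have yc : cu0' B u0 u0' y = c.
  by rewrite /y !cu0'_linear e3 e4 x0' mulr1 mulr0 add0r addr0.
split => //; rewrite /projW ya yc /y.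
by apply/rowP => i; rewrite !mxE; ring.
Qed.

Lemma cu0_projW (R : realType) (V : vectType rat) (B : {symmetric V})
    (u0 u0' : V) (x : Vreal R V) :
  B u0 u0 = 0 -> B u0' u0' = 0 -> B u0 u0' = - (1 / 2) ->
  cu0 B u0 u0' (projW B u0 u0' x) = 0 /\ cu0' B u0 u0' (projW B u0 u0' x) = 0.
Proof.
move=> h0 h0' h1.
have [e1 e2 e3 e4] := cu0_lattice R V B u0 u0' h0 h0' h1.
have E : projW B u0 u0' x = - cu0' B u0 u0' x *: inR R u0' +
    (- cu0 B u0 u0' x *: inR R u0 + x).
  by apply/rowP => i; rewrite !mxE; ring.
rewrite E !cu0_linear !cu0'_linear e1 e2 e3 e4 !mulr0 !mulr1.
by split; ring.
Qed.

Lemma cu0_spaceR (R : realType) (V : vectType rat) (B : {symmetric V})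
    (u0 u0' : V) (b : Vreal R V) : b \in spaceR R (perp2 B u0 u0') ->
  cu0 B u0 u0' b = 0 /\ cu0' B u0 u0' b = 0.
Proof. by rewrite /cu0 /cu0' => /formR_spaceR[-> ->]; rewrite mulr0. Qed.

Lemma aiso_coords (R : realType) (V : vectType rat) (B : {symmetric V})
    (u0 u0' : V) (t : R) (x : Vreal R V) :
  B u0 u0 = 0 -> B u0' u0' = 0 -> B u0 u0' = - (1 / 2) ->
  let y := aiso B u0 u0' t x in
  [/\ cu0 B u0 u0' y = t * cu0 B u0 u0' x,
      cu0' B u0 u0' y = t^-1 * cu0' B u0 u0' x &
      projW B u0 u0' y = projW B u0 u0' x].
Proof.
move=> h0 h0' h1; have [e0 e0'] := cu0_projW R V B u0 u0' x h0 h0' h1.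
have -> : aiso B u0 u0' t x = (t * cu0 B u0 u0' x) *: inR R u0 +
   ((t^-1 * cu0' B u0 u0' x) *: inR R u0' + projW B u0 u0' x).
  by rewrite aisoE; apply/rowP => i; rewrite !mxE; ring.
exact: cu0_combE.
Qed.

Lemma niso_coords (R : realType) (V : vectType rat) (B : {symmetric V})
    (u0 u0' : V) (b x : Vreal R V) :
  B u0 u0 = 0 -> B u0' u0' = 0 -> B u0 u0' = - (1 / 2) ->
  b \in spaceR R (perp2 B u0 u0') ->
  let y := niso B u0 u0' b x in
  [/\ cu0 B u0 u0' y = cu0 B u0 u0' x + 2 * formR B (projW B u0 u0' x) b +
        cu0' B u0 u0' x * formR B b b,
      cu0' B u0 u0' y = cu0' B u0 u0' x &
      projW B u0 u0' y = cu0' B u0 u0' x *: b + projW B u0 u0' x].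
Proof.
move=> h0 h0' h1 /cu0_spaceR[b0 b0'].
have [e0 e0'] := cu0_projW R V B u0 u0' x h0 h0' h1.
have -> : niso B u0 u0' b x =
  (cu0 B u0 u0' x + 2 * formR B (projW B u0 u0' x) b +
     cu0' B u0 u0' x * formR B b b) *: inR R u0 +
  (cu0' B u0 u0' x *: inR R u0' +
    (cu0' B u0 u0' x *: b + projW B u0 u0' x)).
  by rewrite nisoE; apply/rowP => i; rewrite !mxE; ring.
apply: cu0_combE => //; first by rewrite cu0_linear b0 e0 mulr0 addr0.
by rewrite cu0'_linear b0' e0' mulr0 addr0.
Qed.

Lemma cu0_0 (R : realType) (V : vectType rat) (B : {symmetric V}) (u0 u0' : V) :
  [/\ cu0 B u0 u0' (0 : Vreal R V) = 0, cu0' B u0 u0' (0 : Vreal R V) = 0 &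
      projW B u0 u0' (0 : Vreal R V) = 0].
Proof. by rewrite /projW /cu0 /cu0' !formR0l mulr0 !scale0r !subr0. Qed.

Lemma cu0_eq0 (R : realType) (V : vectType rat) (B : {symmetric V})
    (u0 u0' : V) (x : Vreal R V) :
  cu0 B u0 u0' x = 0 -> cu0' B u0 u0' x = 0 -> projW B u0 u0' x = 0 -> x = 0.
Proof.
by move=> e1 e2 e3; rewrite (cu0_decomp R V B u0 u0' x) e1 e2 e3 !scale0r !addr0.
Qed.

(** The [^-1] used in [act_inv] is a pseudo-inverse on endomorphisms; a trivial kernel makes it a
    true inverse. *)
Lemma aiso_inj (R : realType) (V : vectType rat) (B : {symmetric V})
    (u0 u0' : V) (t : R) :
  B u0 u0 = 0 -> B u0' u0' = 0 -> B u0 u0' = - (1 / 2) -> t != 0 ->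
  lker (aiso B u0 u0' t) == 0%VS.
Proof.
move=> h0 h0' h1 tn0; rewrite -subv0; apply/subvP => x; rewrite memv_ker memv0.
move=> /eqP x0; have [e1 e2 e3] := aiso_coords R V B u0 u0' t x h0 h0' h1.
have [z1 z2 z3] := cu0_0 R V B u0 u0'.
rewrite x0 ?z1 ?z2 ?z3 in e1 e2 e3.
apply/eqP; apply: (@cu0_eq0 R V B u0 u0') => //.
  by apply/eqP; have /esym/eqP := e1; rewrite mulf_eq0 (negPf tn0).
by apply/eqP; have /esym/eqP := e2; rewrite mulf_eq0 invr_eq0 (negPf tn0).
Qed.

(** In these coordinates [n(b)] is unitriangular, so a kernel vector loses [cu0'], then [projW],
    then [cu0]. *)
Lemma niso_inj (R : realType) (V : vectType rat) (B : {symmetric V})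
    (u0 u0' : V) (b : Vreal R V) :
  B u0 u0 = 0 -> B u0' u0' = 0 -> B u0 u0' = - (1 / 2) ->
  b \in spaceR R (perp2 B u0 u0') -> lker (niso B u0 u0' b) == 0%VS.
Proof.
move=> h0 h0' h1 bW; rewrite -subv0; apply/subvP => x; rewrite memv_ker memv0.
move=> /eqP x0; have [e1 e2 e3] := niso_coords R V B u0 u0' b x h0 h0' h1 bW.
have [z1 z2 z3] := cu0_0 R V B u0 u0'.
rewrite x0 ?z1 ?z2 ?z3 in e1 e2 e3.
rewrite -e2 scale0r add0r in e3.
rewrite -e2 -e3 formR0l mulr0 mul0r !addr0 in e1.
by apply/eqP; apply: (@cu0_eq0 R V B u0 u0').
Qed.

(** The parameters are recovered from the point: its [u0']-coordinate is [1/t] and its [W]-component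
    is [b/t]. Thus membership of the point in the Siegel set constrains the given [t] and [b]
    themselves. *)
Lemma siegel_point_inj (R : realType) (V : vectType rat) (B : {symmetric V})
    (u0 u0' : V) (t t' : R) (b b' : Vreal R V) :
  B u0 u0 = 0 -> B u0' u0' = 0 -> B u0 u0' = - (1 / 2) -> t != 0 ->
  b \in spaceR R (perp2 B u0 u0') -> b' \in spaceR R (perp2 B u0 u0') ->
  siegel_point B u0 u0' t b = siegel_point B u0 u0' t' b' -> t = t' /\ b = b'.
Proof.
move=> h0 h0' h1 tn0 bW b'W.
have [z1 z2 z3] := cu0_0 R V B u0 u0'.
have E s c : c \in spaceR R (perp2 B u0 u0') ->
    cu0' B u0 u0' (siegel_point B u0 u0' s c) = s^-1 /\
    projW B u0 u0' (siegel_point B u0 u0' s c) = s^-1 *: c.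
  move=> cW; rewrite /siegel_point.
  set v := inR R u0 + _.
  have [_ -> ->] := niso_coords R V B u0 u0' c (aiso B u0 u0' s v) h0 h0' h1 cW.
  have [_ -> ->] := aiso_coords R V B u0 u0' s v h0 h0' h1.
  have -> : v = 1 *: inR R u0 + (1 *: inR R u0' + 0).
    by rewrite !scale1r addr0.
  have [_ -> ->] := cu0_combE R V B u0 u0' 1 1 0 h0 h0' h1 z1 z2.
  by rewrite mulr1 addr0.
move=> tb; have [f1 f2] := E t b bW; have [f1' f2'] := E t' b' b'W.
have tt' : t = t' by apply: invr_inj; rewrite -f1 tb f1'.
split=> //; apply: (@scalerI _ _ t^-1); first by rewrite invr_eq0.
by rewrite -f2 tb f2' tt'.
Qed.

(** Both sides are linear and agree on the basis: [cu0'] is 1 on [u0'] and 0 on [u0], which is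
    isotropic, and on [w], which is orthogonal to [u0]. This identifies the variables generating the
    ideal. *)
Lemma coord_adapted_last (R : realType) (V : vectType rat) (B : {symmetric V})
    (k : nat) (u0 u0' : V) (w : k.-tuple V) (x : Vreal R V) :
  B u0 u0 = 0 -> B u0' u0' = 0 -> B u0 u0' = - (1 / 2) ->
  \dim {:V} = k.+2 -> basis_of (perp2 B u0 u0') w ->
  coord [tuple of map (inR R) (adapted_basis u0 u0' w)] ord_max x =
  cu0' B u0 u0' x.
Proof.
move=> h0 h0' h1 hd wb.
have [e1 e2 e3 e4] := cu0_lattice R V B u0 u0' h0 h0' h1.
have eb := inR_basis R V _ _ (adapted_basisP V B k u0 u0' w h0 h0' h1 hd wb).
have cu0'_basis (i : 'I_k.+2) : cu0' B u0 u0'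
    ([tuple of map (inR R) (adapted_basis u0 u0' w)]`_i) = (i == ord_max)%:R.
  rewrite (nth_map 0) ?size_tuple // -(inj_eq val_inj) /=.
  case: i => [[|i] /=]; rewrite ?e3 // !ltnS eqSS leq_eqVlt nth_rcons size_tuple.
  case: ltngtP => //= ik _.
  have iw : w`_i \in w by rewrite mem_nth // size_tuple.
  rewrite /cu0' formR_inR.
  have /mem_orthovP -> := basis_mem wb iw; first by rewrite rmorph0 mulr0.
  exact: (subvP (addvSl _ _)) (memv_line _).
rewrite [x in RHS](coord_basis eb (memvf x)).
rewrite linear_fun_sum; last by move=> *; apply: cu0'_linear.
rewrite (bigD1 ord_max) // cu0'_basis eqxx mulr1 big1 => [|i im].
  by rewrite /= addr0.
by rewrite cu0'_basis (negPf im) mulr0.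
Qed.

(** * Discreteness on the coset and boundedness on the Siegel set *)

Lemma common_denominator (I : finType) (r : I -> rat) :
  exists2 D : nat, (0 < D)%N & forall i, D%:R * r i \is a Num.int.
Proof.
exists (\prod_i `|denq (r i)|)%N => [|i].
  by rewrite prodn_gt0 // => i; rewrite absz_gt0 denq_neq0.
rewrite (bigD1 i) //= mulnC natrM -mulrA rpredM ?rpred_nat //.
by rewrite pmulrn gez0_abs ?denq_ge0 // mulrC -numqE rpred_int.
Qed.

(** If [D] clears the denominators of the coordinate on the [h j] and on a basis of [L], all its
    values on the coset lie in [(1/D)Z]; hence [delta = 1/D]. *)
Lemma cu0'_inR_gap (R : realType) (V : vectType rat) (B : {symmetric V})
    (u0 u0' : V) (L : set V) (n : nat) (h : {ffun 'I_n -> V}) :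
  Zlattice L ->
  exists2 delta : R, 0 < delta & forall X j, lattice_coset L h X ->
    cu0' B u0 u0' (inR R (X j)) != 0 ->
    delta <= `|cu0' B u0 u0' (inR R (X j))|.
Proof.
move=> [e [_ ->]].
pose r (i : 'I_n + 'I_(\dim {:V})) : rat := match i with
  inl j => - 2 * B (h j) u0 | inr i => - 2 * B (tnth e i) u0 end.
have [D D0 Dr] := common_denominator _ r.
exists D%:R^-1 => [|X j /(_ j)[z Xz]]; first by rewrite invr_gt0 ltr0n.
have -> : cu0' B u0 u0' (inR R (X j)) = ratr (- 2 * B (X j) u0).
  by rewrite /cu0' formR_inR rmorphM rmorphN /= rmorph_nat.
have Dint : D%:R * (- 2 * B (X j) u0) \is a Num.int.
  rewrite -[X j](subrK (h j)) Xz linearDl /= linear_sumlz mulrDr mulrDr.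
  apply: rpredD; last exact: (Dr (inl j)).
  rewrite !mulr_sumr; apply: rpred_sum => i _.
  rewrite -scaler_int linearZl_LR /=.
  have -> : D%:R * (- 2 * ((z i)%:~R * B (tnth e i) u0)) =
            (z i)%:~R * (D%:R * r (inr i)) by rewrite /r; ring.
  by apply: rpredM; rewrite ?rpred_int.
set x := - 2 * _ in Dint *; rewrite fmorph_eq0 => x0.
rewrite -(ler_pM2l (_ : 0 < D%:R)) ?ltr0n // mulfV ?pnatr_eq0 -?lt0n //.
rewrite -[D%:R]normr_nat -normrM -(ratr_nat R D) -rmorphM /=.
apply: norm_intr_ge1; last by rewrite fmorph_eq0 mulf_neq0 // pnatr_eq0 -lt0n.
by move/intrP: Dint => [m ->]; rewrite ratr_int rpred_int.
Qed.

Lemma compact_coord_bounded (R : realType) (d : nat) (omega : set 'rV[R]_d)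
    (i : 'I_d) :
  compact (closure omega) -> dominated omega (fun=> 1) (fun b => b 0 i).
Proof.
move=> co; have /compact_bounded [M [_ HM]] :
    compact [set (b : 'rV[R]_d) 0 i | b in closure omega].
  apply: continuous_compact co; apply: continuous_subspaceT.
  exact: coord_continuous.
(* [compact_bounded] gives a bound by every number strictly above [M]; this one is also
   nonnegative. *)
exists (`|M| + 1) => [|b ob]; first by rewrite addr_ge0.
rewrite mulr1; apply: HM; first by rewrite ltr_pwDr // ler_norm.
by exists b => //; apply: subset_closure.
Qed.

(** Linear functionals of [Y] are [O(sqrt (Re Q Y))]. The map [n(b) a(t)] adds at most one factor
    [t], its other coefficients being bounded for [b] in [omega] and [t > t0]. *)
Lemma dominated_niso_aiso (R : realType) (V : vectType rat) (B : {symmetric V})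
    (u0 u0' : V) (n : nat) (Q : {ffun 'I_n -> Vreal R V} -> R[i])
    (omega : set (Vreal R V)) (t0 : R) (l : {scalar Vreal R V}) (j : 'I_n) :
  B u0 u0 = 0 -> B u0' u0' = 0 -> B u0 u0' = - (1 / 2) ->
  quadratic_form Q -> posdef_Re Q -> compact (closure omega) -> 0 < t0 ->
  dominated
    [set x : R * Vreal R V * {ffun 'I_n -> Vreal R V} |
      t0 < x.1.1 /\ omega x.1.2]
    (fun x => x.1.1 * Num.sqrt (complex.Re (Q x.2)))
    (fun x => l (niso B u0 u0' x.1.2 (aiso B u0 u0' x.1.1 (x.2 j)))).
Proof.
move=> h0 h0' h1 hQ hpos co t00; set D := [set x | _]; set W := fun x => x.1.1 * _.
have lin_t (m : Vreal R V -> R) : (forall a x y, m (a *: x + y) = a * m x + m y) ->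
    dominated D W (fun x => x.1.1 * m (x.2 j)).
  move=> ml; have [a x y|C C0 HC] := @posdef_dominates_linear R _ Q
      (fun Y => m (Y j)) hQ hpos.
    by rewrite !ffunE ml.
  exists (Num.sqrt C) => [|x [tx _]]; first exact: sqrtr_ge0.
  have t_ge0 : 0 <= x.1.1 by rewrite ltW // (lt_trans t00).
  rewrite normrM ger0_norm // /W mulrCA ler_wpM2l // -sqrtrM //.
  by rewrite -sqrtr_sqr ler_wsqrtr.
have bd_Vt : dominated D (fun=> 1) (fun x => x.1.1^-1).
  exists t0^-1 => [|x [tx _]]; first by rewrite invr_ge0 ltW.
  have t_gt0 := lt_trans t00 tx.
  by rewrite mulr1 gtr0_norm ?invr_gt0 // lef_pV2 ?posrE // ltW.
(* The missing factor [t] is supplied by [1/t <= 1/t0]. *)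
have lin (m : Vreal R V -> R) : (forall a x y, m (a *: x + y) = a * m x + m y) ->
    dominated D W (fun x => m (x.2 j)).
  move=> ml; have [C C0 HC] := dominatedM bd_Vt (lin_t m ml).
  exists C => // x Dx; have := HC x Dx; rewrite mulKf // gt_eqF //.
  by case: Dx => /(lt_trans t00).
have bd_b i : dominated D (fun=> 1) (fun x => x.1.2 0 i).
  have [C C0 HC] := compact_coord_bounded R _ omega i co.
  by exists C => // x [_ /HC].
have bd_lb : dominated D (fun=> 1) (fun x => l x.1.2).
  apply: (@eq_dominated _ _ D _
      (fun x => \sum_i x.1.2 0 i * l (delta_mx 0 i))) => [x|].
    rewrite [in RHS](row_sum_delta x.1.2) linear_sum.
    by apply: eq_bigr => i _; rewrite linearZ.
  by apply: dominated_sum => i; apply: dominatedM => //; apply: dominated_cst.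
have bd_bb : dominated D (fun=> 1) (fun x => formR B x.1.2 x.1.2).
  do 2![apply: dominated_sum => ?].
  by apply: dominatedM; [apply: dominatedM|apply: dominated_cst].
have dom_pb : dominated D W (fun x => formR B (projW B u0 u0' (x.2 j)) x.1.2).
  apply: (@eq_dominated _ _ D W (fun x => \sum_i \sum_k
     (x.1.2 0 k * ratr (B (tnth (vbasis {:V}) i) (tnth (vbasis {:V}) k))) *
     projW B u0 u0' (x.2 j) 0 i)) => [x|].
    do 2![apply: eq_bigr => ? _]; ring.
  apply: dominated_sum => i; apply: dominated_sum => k.
  have bd_bB : dominated D (fun=> 1) (fun x => x.1.2 0 k *
      ratr (B (tnth (vbasis {:V}) i) (tnth (vbasis {:V}) k))).
    by apply: dominatedM => //; apply: dominated_cst.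
  apply: (dominatedM bd_bB).
  apply: (lin (fun v => projW B u0 u0' v 0 i)) => a x y.
  by rewrite projW_linear !mxE.
(* The expansion of [l (n(b) a(t) Y_j)] in the coordinates of [Y_j]: only the [cu0] term carries
   [t], and the remaining terms involve only [b] and [1/t]. *)
apply: (@eq_dominated _ _ D W (fun x =>
   l (inR R u0) * (x.1.1 * cu0 B u0 u0' (x.2 j)) +
   (l (projW B u0 u0' (x.2 j)) +
    ((2 * l (inR R u0)) * formR B (projW B u0 u0' (x.2 j)) x.1.2 +
    (x.1.1^-1 * (l (inR R u0') + (l x.1.2 +
       l (inR R u0) * formR B x.1.2 x.1.2))) * cu0' B u0 u0' (x.2 j))))) => [x|]; last first.
  apply: dominatedD.
    apply: dominatedM; first exact: dominated_cst.
    by apply: (lin_t (cu0 B u0 u0')) => *; apply: cu0_linear.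
  apply: dominatedD.
    apply: (lin (fun v => l (projW B u0 u0' v))) => a x y.
    by rewrite projW_linear linearP.
  apply: dominatedD.
    by apply: dominatedM => //; apply: dominated_cst.
  apply: dominatedM; last first.
    by apply: (lin (cu0' B u0 u0')) => *; apply: cu0'_linear.
  apply: dominatedM => //; apply: dominatedD; first exact: dominated_cst.
  apply: dominatedD => //; apply: dominatedM => //; exact: dominated_cst.
have [e1 e2 e3] := aiso_coords R V B u0 u0' x.1.1 (x.2 j) h0 h0' h1.
rewrite nisoE e1 e2 e3 !(linearD, linearZ) /=; ring.
Qed.

(** * Estimate of one term and summation over the coset *)

(** The exponent is shared out: [q/2] absorbs [(1 + q)^N], and the other half is at least [c t^2/2].
    Of this, [c t^2/4] absorbs [t^(2N)], and the rest is at least [(c t0/4) t]. *)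
Lemma gaussian_term_le (R : realType) (t0 c E : R) (N : nat) :
  0 < t0 -> 0 < c -> 0 < E ->
  exists2 A, 0 < A & forall q t P, t0 < t -> c * t ^+ 2 <= q -> 0 < P ->
    P <= (E * t ^+ 2 * (1 + q)) ^+ N ->
    expR (- q) <= A * expR (- (c * t0 / 4) * t) * P^-1.
Proof.
move=> t00 c0 E0.
have [A A0 HA] := expr1D_le_expR R N (2^-1) (ltac:(by rewrite invr_gt0)).
have [K K0 HK] := expr1D_le_expR R N (c / 4) (ltac:(by rewrite divr_gt0)).
exists (E ^+ N * A * K) => [|q t P tt cq P0 HP].
  by rewrite !mulr_gt0 // exprn_gt0.
have t_gt0 := lt_trans t00 tt.
have q0 : 0 <= q by apply: le_trans cq; rewrite mulr_ge0 ?sqr_ge0 ?ltW.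
rewrite ler_pdivlMr //.
apply: le_trans (ler_wpM2l (expR_ge0 _) HP) _.
rewrite exprMn (exprMn _ E).
have hK : (t ^+ 2) ^+ N <= K * expR (c / 4 * t ^+ 2).
  apply: le_trans (HK _ (sqr_ge0 _)); apply: lerXn2r; rewrite ?nnegrE ?sqr_ge0 //.
    by rewrite addr_ge0 ?sqr_ge0.
  by rewrite lerDr.
apply: (@le_trans _ _ (expR (- q) * (E ^+ N * (K * expR (c / 4 * t ^+ 2)) *
   (A * expR (2^-1 * q))))).
  rewrite ler_wpM2l ?expR_ge0 //; apply: ler_pM; last exact: HA.
  - by apply: mulr_ge0; apply: exprn_ge0; rewrite ?sqr_ge0 ?ltW.
  - by rewrite exprn_ge0 ?addr_ge0.
  - by rewrite ler_wpM2l ?exprn_ge0 ?(ltW E0).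
rewrite (_ : _ * _ = E ^+ N * A * K *
  (expR (- q) * expR (c / 4 * t ^+ 2) * expR (2^-1 * q))); last by ring.
rewrite ler_wpM2l ?mulr_ge0 ?exprn_ge0 ?(ltW E0) ?(ltW A0) ?(ltW K0) //.
rewrite -!expRD ler_expR.
have : c * t0 * t <= c * t ^+ 2.
  by rewrite -mulrA ler_wpM2l ?(ltW c0) // expr2 ler_wpM2r ?ltW.
have : 0 <= c * t ^+ 2 by rewrite mulr_ge0 ?sqr_ge0 ?ltW.
nra.
Qed.

Lemma Re_posdef_ge0 (R : realType) (U : lmodType R) (Q : U -> R[i]) (x : U) :
  quadratic_form Q -> posdef_Re Q -> 0 <= complex.Re (Q x).
Proof.
move=> [S [Sl _ QS]] Qpos; have [->|/Qpos/ltW//] := eqVneq x 0.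
have := Sl (-1) 0 0 0; rewrite scaler0 addr0 rmorphN mulN1r addNr => S0.
by rewrite QS S0.
Qed.

Lemma niso_aiso_act_inv (R : realType) (V : vectType rat) (B : {symmetric V})
    (u0 u0' : V) (n : nat) (t : R) (b : Vreal R V) (X : {ffun 'I_n -> V})
    (j : 'I_n) :
  B u0 u0 = 0 -> B u0' u0' = 0 -> B u0 u0' = - (1 / 2) -> t != 0 ->
  b \in spaceR R (perp2 B u0 u0') ->
  niso B u0 u0' b (aiso B u0 u0' t (act_inv B u0 u0' t b X j)) = inR R (X j).
Proof.
move=> h0 h0' h1 t0 bW; rewrite ffunE.
by rewrite (lker0_lfunVK (aiso_inj _ _ _ _ _ _ h0 h0' h1 t0))
           (lker0_lfunVK (niso_inj _ _ _ _ _ _ h0 h0' h1 bW)).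
Qed.

(** [n(b)] fixes the [u0']-coordinate and [a(t)] divides it by [t]; undoing both produces the factor
    [t] that drives the decay. *)
Lemma cu0'_act_inv (R : realType) (V : vectType rat) (B : {symmetric V})
    (u0 u0' : V) (n : nat) (t : R) (b : Vreal R V) (X : {ffun 'I_n -> V})
    (j : 'I_n) :
  B u0 u0 = 0 -> B u0' u0' = 0 -> B u0 u0' = - (1 / 2) -> t != 0 ->
  b \in spaceR R (perp2 B u0 u0') ->
  cu0' B u0 u0' (act_inv B u0 u0' t b X j) = t * cu0' B u0 u0' (inR R (X j)).
Proof.
move=> h0 h0' h1 tn0 bW.
rewrite -(niso_aiso_act_inv R V B u0 u0' n t b X j h0 h0' h1 tn0 bW).
set y := act_inv _ _ _ _ _ _ _.
have [_ -> _] := niso_coords R V B u0 u0' b (aiso B u0 u0' t y) h0 h0' h1 bW.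
have [_ -> _] := aiso_coords R V B u0 u0' t y h0 h0' h1.
by rewrite mulVKf.
Qed.

Lemma yeval_last_row0 (R : realType) (k n : nat) (p : ypoly R k.+1 n)
    (y : 'M[R]_(k.+1, n)) :
  in_last_row_ideal p -> (forall j, y ord_max j = 0) -> yeval p y = 0.
Proof.
move=> [c ->] y0; rewrite /yeval.
rewrite (big_morph _ (mpoly.mevalD _) (mpoly.meval0 _)) big1 // => j _.
by rewrite mpoly.mevalM mpoly.mevalXU mxvecE y0 mulr0.
Qed.

(** [\esum] is a supremum over finite subsets. Injectivity of [z] sends each of them to a
    duplicate-free list of integer vectors, whose sum has a bound independent of the subset. *)
Lemma esum_lattice_coset_le (R : realType) (V : vectType rat) (n d : nat)
    (D : set {ffun 'I_n -> V}) (z : {ffun 'I_n -> V} -> {ffun 'I_n * 'I_d -> int})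
    (f : {ffun 'I_n -> V} -> R) (K : R) :
  {in D &, injective z} -> 0 <= K ->
  (forall X, D X -> f X <= K * (\prod_i (1 + (z X i)%:~R ^+ 2))^-1) ->
  (\esum_(X in D) (f X)%:E <= (K * 6 ^+ #|{: 'I_n * 'I_d}|)%:E)%E.
Proof.
move=> zinj K0 fK; apply: ge_ereal_sup => _ [A [finA AD] <-].
have As X : X \in finmap.enum_fset (fset_set A) -> D X.
  by move=> XA; apply: AD; move: XA; rewrite in_fset_set // inE.
rewrite fsbig_finite //= sumEFin lee_fin.
apply: (@le_trans _ _ (K * \sum_(X <- finmap.enum_fset (fset_set A))
    \prod_i (1 + (z X i)%:~R ^+ 2)^-1)).
  rewrite mulr_sumr big_seq [leRHS]big_seq; apply: ler_sum => X /As DX.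
  by rewrite prodfV; apply: fK.
rewrite ler_wpM2l // -(big_map z predT
  (fun s : {ffun 'I_n * 'I_d -> int} => \prod_i (1 + (s i)%:~R ^+ 2)^-1)).
apply: sum_prod_inv1Dsq_le; rewrite map_inj_in_uniq ?finmap.fset_uniq //.
by move=> X Y /As XD /As YD; apply: zinj; rewrite inE.
Qed.

Lemma inR_coset_coord (R : realType) (V : vectType rat) (d : nat)
    (e : d.-tuple V) (v v0 : V) (z : 'I_d -> int) (i : 'I_d) :
  basis_of fullv e -> v - v0 = \sum_i tnth e i *~ z i ->
  coord [tuple of map (inR R) e] i (inR R v) =
  (z i)%:~R + coord [tuple of map (inR R) e] i (inR R v0).
Proof.
move=> eb vz; have reb := inR_basis R V _ _ eb.
set f := [tuple of map (inR R) e] in reb *.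
have coordE k : coord f i (inR R (tnth e k)) = (k == i)%:R.
  by rewrite -(coord_free _ _ (basis_free reb)) -tnth_nth tnth_map.
rewrite -[v](subrK v0) vz -[\sum_i _]scale1r inR_linear rmorph1 scale1r linearD.
congr (_ + _); rewrite (eq_bigr (fun i => (z i)%:~R *: tnth e i)); last first.
  by move=> k _; rewrite scaler_int.
rewrite inR_sum linear_sum (bigD1 i) // big1 => [|k ki]; rewrite linearZ ratr_int.
  by rewrite /= coordE eqxx mulr1 addr0.
by rewrite /= coordE (negPf ki) mulr0.
Qed.

(** * Exponential decay of the theta series *)

Theorem lemma5p1 (R : realType) (p0 : nat) (V : vectType rat)
    (B : {symmetric V})
    (hdim : \dim {:V} = p0.+1)
    (hnd : nondegenerate B)
    (hsig : has_signature B p0 1)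
    (u0 u0' : V)
    (hu0 : B u0 u0 = 0) (hu0' : B u0' u0' = 0)
    (hu0u0' : B u0 u0' = - (1 / 2))
    (L : set V)
    (hL : Zlattice L)
    (hLdual : L `<=` dual_lattice B L)
    (hLsplit : lattice_splits B u0 u0' L)
    (n : nat) (hn1 : (1 <= n)%N) (hnp : (n <= p0)%N)
    (h : {ffun 'I_n -> V})
    (hh : forall j, dual_lattice B L (h j))
    (w : (p0.-1).-tuple V)
    (hw : basis_of (perp2 B u0 u0') w)
    (Q : {ffun 'I_n -> Vreal R V} -> R[i])
    (hQ : quadratic_form Q)
    (hQpos : posdef_Re Q)
    (omega : set (Vreal R V))
    (homegaW : open_in omega [set` spaceR R (perp2 B u0 u0')])
    (homegac : compact (closure omega))
    (t0 : R) (ht0 : 0 < t0)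
    (p : ypoly R (p0.-1).+2 n)
    (hphom : homogeneous_ypoly p)
    (hpideal : in_last_row_ideal p) :
  exists C1 C2 : R, [/\ 0 < C1, 0 < C2 &
    forall (t : R) (b : Vreal R V),
      0 < t -> b \in spaceR R (perp2 B u0 u0') ->
      siegel_set B u0 u0' omega t0 (siegel_point B u0 u0' t b) ->
      (theta_star B u0 u0' w L h p t b Q <= (C1 * expR (- C2 * t))%:E)%E].
Proof.
(* The predecessor is not truncated here: [1 <= n <= p0] makes [p0] positive. *)
have hd : \dim {:V} = (p0.-1).+2 by rewrite hdim prednK // (leq_trans hn1).
pose q Y := complex.Re (Q Y).
have q0 Y : 0 <= q Y by exact: Re_posdef_ge0.
have [Ap Ap0 HAp] : exists2 A, 0 < A & forall Y,
    Normc.normc (yeval p (ycoord u0 u0' w Y)) <= A * expR (q Y).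
  have /choice[C HC] (m : 'I_(p0.-1.+2 * n)) : exists c, 0 <= c /\
      forall Y, mxvec (ycoord u0 u0' w Y) 0 m ^+ 2 <= c * q Y.
    have [c x y|c c0 Hc] := posdef_dominates_linear R _ Q
        (fun Y => mxvec (ycoord u0 u0' w Y) 0 m) hQ hQpos; last by exists c.
    by case/mxvec_indexP: m => i j; rewrite !mxvecE !mxE !ffunE linearP.
  apply: (normc_mpoly_le R _ _ p (fun Y => mxvec (ycoord u0 u0' w Y) 0) q C) => //.
    by move=> m; case: (HC m).
  by move=> Y m; case: (HC m).
have [delta delta0 Hdelta] := cu0'_inR_gap R V B u0 u0' L n h hL.
have /choice[K HK] (j : 'I_n) : exists c, 0 <= c /\
    forall Y : {ffun 'I_n -> Vreal R V}, cu0' B u0 u0' (Y j) ^+ 2 <= c * q Y.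
  have [c x y|c c0 Hc] := posdef_dominates_linear R _ Q
      (fun Y => cu0' B u0 u0' (Y j)) hQ hQpos; last by exists c.
  by rewrite !ffunE cu0'_linear.
have [e [eb LE]] := hL.
pose f := [tuple of map (inR R) e].
have /choice[G HG] (a : 'I_n * 'I_(\dim {:V})) : exists c, 0 <= c /\
    forall t b (Y : {ffun 'I_n -> Vreal R V}), t0 < t -> omega b ->
    `|coord f a.2 (niso B u0 u0' b (aiso B u0 u0' t (Y a.1)))|
      <= c * (t * Num.sqrt (q Y)).
  have [c c0 Hc] := dominated_niso_aiso R V B u0 u0' n Q omega t0
    (coord f a.2) a.1 hu0 hu0' hu0u0' hQ hQpos homegac ht0.
  by exists c; split=> // t b Y tt ob; apply: (Hc (t, b, Y)).
(* The integer coordinates of [X - h] in the lattice basis, with value 0 off the coset to make [z]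
   total. *)
have /choice[z Hz] (X : {ffun 'I_n -> V}) :
    exists z : {ffun 'I_n * 'I_(\dim {:V}) -> int}, lattice_coset L h X ->
      forall j, X j - h j = \sum_i tnth e i *~ z (j, i).
  have [XL|nXL] := pselect (lattice_coset L h X); last by exists [ffun=> 0].
  have /choice[zX HzX] j : exists zj : 'I_(\dim {:V}) -> int,
      X j - h j = \sum_i tnth e i *~ zj i.
    by have := XL j; rewrite LE.
  exists [ffun a => zX a.1 a.2] => _ j; rewrite HzX.
  by under [RHS]eq_bigr do rewrite ffunE.
have zinj : {in lattice_coset L h &, injective z}.
  move=> X Y; rewrite !inE => XL YL zXY; apply/ffunP => j.
  by apply: (addIr (- h j)); rewrite (Hz X XL) (Hz Y YL) zXY.
pose H (a : 'I_n * 'I_(\dim {:V})) : R := coord f a.2 (inR R (h a.1)).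
(* Chosen so that [1 + z^2 <= Ea a * t^2 * (1 + q Y)] for the coordinate [z] of index [a]; dividing
   by [t0^2] lets [t > t0] absorb the terms free of [t]. *)
pose Ea a := 2 * G a ^+ 2 + (1 + 2 * H a ^+ 2) / t0 ^+ 2.
have nonneg (x : R) : 0 <= 1 + 2 * x ^+ 2 by have := sqr_ge0 x; lra.
have Ea0 a : 0 <= Ea a.
  apply: addr_ge0; first by rewrite mulr_ge0 ?sqr_ge0.
  by apply: divr_ge0; rewrite ?sqr_ge0.
pose E := 1 + \sum_a Ea a.
have E0 : 0 < E by rewrite ltr_pwDl // sumr_ge0.
pose K1 := 1 + \sum_j K j.
have K10 : 0 < K1 by rewrite ltr_pwDl // sumr_ge0 // => j _; case: (HK j).
(* From [delta^2 t^2 <= cu0'(Y_j)^2 <= K1 * q Y] whenever the [u0']-coordinate of [X_j] is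
   nonzero. *)
pose c := delta ^+ 2 / K1.
have c0 : 0 < c by rewrite divr_gt0 ?exprn_gt0.
have [A A0 HA] := gaussian_term_le R t0 c E #|{: 'I_n * 'I_(\dim {:V})}| ht0 c0 E0.
exists (Ap * A * 6 ^+ #|{: 'I_n * 'I_(\dim {:V})}|), (c * t0 / 4); split.
- by rewrite !mulr_gt0 // exprn_gt0.
- by rewrite divr_gt0 // mulr_gt0.
(* Membership in the Siegel set provides its own parameters [b'], [t'], which must be identified
   with [b], [t]. *)
move=> t b t_gt0 bW [b' [t' [ob' tt' sieg]]].
have b'W : b' \in spaceR R (perp2 B u0 u0').
  by case: homegaW => U _ omE; move: ob'; rewrite omE => -[].
have [Et Eb] := siegel_point_inj R V B u0 u0' t t' b b' hu0 hu0' hu0u0'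
  (lt0r_neq0 t_gt0) bW b'W sieg.
rewrite -Et in tt'; rewrite -Eb in ob' => {sieg Et Eb t' b' b'W}.
have tn0 := lt0r_neq0 t_gt0.
rewrite mulrAC; apply: esum_lattice_coset_le zinj _ _ => [|X XL].
  by rewrite !mulr_ge0 ?expR_ge0 ?(ltW A0) ?(ltW Ap0).
cbv zeta; set Y := act_inv _ _ _ _ _ _.
set P := \prod_i _.
have P0 : 0 < P by apply: prodr_gt0 => a _; rewrite ltr_pwDl ?sqr_ge0.
(* If every [u0']-coordinate of [X] vanishes, the ideal condition kills the term; otherwise some
   coordinate is bounded below by the gap. *)
have [allz|] := pselect (forall j, cu0' B u0 u0' (inR R (X j)) = 0).
  rewrite yeval_last_row0 // ?mul0r ?Normc.normc0.
    by rewrite !mulr_ge0 ?invr_ge0 ?expR_ge0 ?(ltW A0) ?(ltW Ap0) ?(ltW P0).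
  move=> j; rewrite mxE (coord_adapted_last R V B) //.
  by rewrite /Y cu0'_act_inv // allz mulr0.
move=> /existsNP[j /eqP gj].
have cq : c * t ^+ 2 <= q Y.
  have Kj : cu0' B u0 u0' (Y j) ^+ 2 <= K1 * q Y.
    apply: le_trans ((HK j).2 Y) _; rewrite ler_wpM2r // /K1 (bigD1 j) //=.
    rewrite addrCA lerDl addr_ge0 // sumr_ge0 // => i _; exact: (HK i).1.
  rewrite /c mulrAC ler_pdivrMr // [leRHS]mulrC; apply: le_trans Kj.
  rewrite /Y cu0'_act_inv // exprMn mulrC ler_wpM2l ?sqr_ge0 //.
  rewrite -[leRHS]real_normK ?num_real // lerXn2r ?nnegrE ?(ltW delta0) //.
  exact: Hdelta.
rewrite Normc.normcM normc_cexp.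
have -> : complex.Re (- (pi%:C%C * Q Y)) = - (pi * q Y).
  by rewrite /q; case: (Q Y) => u v /=; ring.
(* The bound [expR (q Y)] on the polynomial is paid for by [pi >= 2]: [q - pi q <= - q]. *)
apply: (@le_trans _ _ (Ap * expR (- q Y))).
  apply: le_trans (ler_wpM2r (expR_ge0 _) (HAp Y)) _.
  rewrite -mulrA ler_wpM2l ?(ltW Ap0) // -expRD ler_expR.
  by have := pi_ge2 R; have := q0 Y; nra.
rewrite -[leRHS]mulrA -[leRHS]mulrA ler_wpM2l ?(ltW Ap0) // [leRHS]mulrA.
apply: HA => //.
rewrite /P -prodr_const; apply: ler_prod => -[j' i] _.
rewrite addr_ge0 ?sqr_ge0 //=.
apply: (@le_trans _ _ (Ea (j', i) * t ^+ 2 * (1 + q Y))); last first.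
  rewrite ler_wpM2r ?addr_ge0 // ler_wpM2r ?sqr_ge0 // /E (bigD1 (j', i)) //=.
  by rewrite addrCA lerDl addr_ge0 // sumr_ge0.
(* As [n(b) a(t) Y_j = X_j], this bounds the real coordinate of [X_j], that is [x + r] with [x] an
   integer and [r] the coordinate of [h]. *)
have := (HG (j', i)).2 t b Y tt' ob'.
rewrite /Y niso_aiso_act_inv // (inR_coset_coord _ _ _ _ _ (h j') (fun i => z X (j', i))) //;
  last exact: Hz.
rewrite -/Y /= -[coord f i _]/(H (j', i)).
set s := Num.sqrt _; have s2 : s ^+ 2 = q Y by rewrite sqr_sqrtr.
have s0 : 0 <= s by exact: sqrtr_ge0.
rewrite /Ea; have := (HG (j', i)).1.
move: (G (j', i)) (H (j', i)) ((z X (j', i))%:~R : R) => g r x g0 xr.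
have x2 : x ^+ 2 <= 2 * (g ^+ 2 * t ^+ 2 * q Y) + 2 * r ^+ 2.
  have: (x + r) ^+ 2 <= g ^+ 2 * t ^+ 2 * q Y.
    rewrite -s2 -!exprMn -(real_normK (num_real (x + r))) -mulrA.
    by rewrite lerXn2r ?nnegrE ?mulr_ge0 ?(ltW t_gt0).
  (* [2 (x + r)^2 + 2 r^2 - x^2 = (x + 2 r)^2]. *)
  have := sqr_ge0 (x + 2 * r); nra.
have r2 : 1 + 2 * r ^+ 2 <= (1 + 2 * r ^+ 2) / t0 ^+ 2 * t ^+ 2.
  rewrite -mulrA ler_peMr //.
  rewrite ler_pdivlMl ?exprn_gt0 // mulr1.
  by rewrite lerXn2r ?nnegrE ?(ltW t_gt0) ?(ltW ht0) ?(ltW tt').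
set v := (_ / _) in r2 *.
have := mulr_ge0 (sqr_ge0 g) (sqr_ge0 t).
have v0 : 0 <= v * t ^+ 2.
  exact: le_trans r2.
have := mulr_ge0 v0 (q0 Y).
nra.
Qed.
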